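(* Let $G_1$ be an $r_1$-regular graph on $n_1$ vertices and $m_1$ edges, and $G_2$ an arbitrary graph on $n_2$ vertices. Then $$\phi\left(A(G_1\underline{\vee} G_2);x\right)=\phi(A(G_2);x)\cdot x^{m_1-n_1}\cdot\Big(x^2-m_1 x\,\Gamma_{A(G_2)}(x)-2r_1\Big)\cdot\prod_{i=2}^{n_1}\Big(x^2-r_1-\lambda_i(G_1)\Big).$$
   Context: All graphs are finite, simple and undirected, with at least one vertex. For a graph $G$ on $n$ vertices, $A(G)$ is its adjacency matrix, with eigenvalues $\lambda_1(G)\ge\lambda_2(G)\ge\cdots\ge\lambda_n(G)$. For an $n\times n$ matrix $M$, $\phi(M;x)=\det(xI_n-M)$ is its characteristic polynomial, and the $M$-coronal is the rational function $\Gamma_M(x)=\mathbf{1}_n^T(xI_n-M)^{-1}\mathbf{1}_n$ (the sum of the entries of $(xI_n-M)^{-1}$), where $\mathbf{1}_n$ is the all-ones column vector. The subdivision graph $\mathcal{S}(G)$ is obtained from $G$ by inserting a new vertex into every edge of $G$; $I(G)$ denotes the set of inserted vertices. For vertex-disjoint graphs $G_1,G_2$, the subdivision-edge join $G_1\underline{\vee}G_2$ is the graph obtained from $\mathcal{S}(G_1)$ and $G_2$ by joining every vertex of $I(G_1)$ with every vertex of $V(G_2)$. The identity is understood as an identity of rational functions in $x$ (the exponent $m_1-n_1$ may be negative). *)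

(* Defs.v *)
From mathcomp Require Import all_boot all_order all_algebra.
From mathcomp Require Import polyrcf.

Set Implicit Arguments.
Unset Strict Implicit.
Unset Printing Implicit Defensive.

Import Order.TTheory GRing.Theory Num.Theory.
Local Open Scope ring_scope.

Record sgraph := SGraph {
  vertex :> finType;
  adj : rel vertex;
  adj_sym : symmetric adj;
  adj_irrefl : irreflexive adj;
  vertex_gt0 : (0 < #|vertex|)%N
}.

Definition edges (G : sgraph) : {set {set G}} :=
  [set e : {set G} | [exists x, exists y, adj x y && (e == [set x; y])]].

Definition regular (G : sgraph) (r : nat) : Prop :=
  forall x : G, #|[set y : G | adj x y]| = r.

Section Subdivision.
Variable G : sgraph.

(* [inl x] is an original vertex, [inr e] the vertex inserted into the edge
   [e]. *)
Definition subdiv_vertex : finType := (G + {e : {set G} | e \in edges G})%type.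

Definition subdiv_adj : rel subdiv_vertex := fun a b =>
  match a, b with
  | inl x, inr e => x \in val e
  | inr e, inl x => x \in val e
  | _, _ => false
  end.

Lemma subdiv_adj_sym : symmetric subdiv_adj.
Proof. by case=> x [] y. Qed.

Lemma subdiv_adj_irrefl : irreflexive subdiv_adj.
Proof. by case. Qed.

Lemma subdiv_vertex_gt0 : (0 < #|subdiv_vertex|)%N.
Proof. by rewrite card_sum ltn_addr // vertex_gt0. Qed.

Definition subdivision : sgraph :=
  SGraph subdiv_adj_sym subdiv_adj_irrefl subdiv_vertex_gt0.

Definition inserted : {set subdivision} :=
  [set a : subdiv_vertex | if a is inr _ then true else false].

End Subdivision.

Section SubdivisionEdgeJoin.
Variables G1 G2 : sgraph.

Definition sej_vertex : finType := (subdivision G1 + G2)%type.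

Definition sej_adj : rel sej_vertex := fun a b =>
  match a, b with
  | inl x, inl y => adj x y
  | inr x, inr y => adj x y
  | inl x, inr _ => x \in inserted G1
  | inr _, inl y => y \in inserted G1
  end.

Lemma sej_adj_sym : symmetric sej_adj.
Proof.
case=> x [] y //; [exact: (@adj_sym (subdivision G1)) | exact: (@adj_sym G2)].
Qed.

Lemma sej_adj_irrefl : irreflexive sej_adj.
Proof.
case=> x; [exact: (@adj_irrefl (subdivision G1)) | exact: (@adj_irrefl G2)].
Qed.

Lemma sej_vertex_gt0 : (0 < #|sej_vertex|)%N.
Proof. by rewrite card_sum ltn_addr // vertex_gt0. Qed.

Definition subdiv_edge_join : sgraph :=
  SGraph sej_adj_sym sej_adj_irrefl sej_vertex_gt0.

End SubdivisionEdgeJoin.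

Definition adjmx (R : nzRingType) (G : sgraph) : 'M[R]_#|G| :=
  \matrix_(i, j) (adj (enum_val i) (enum_val j))%:R.

(* The roots of the characteristic polynomial, repeated according to
   multiplicity, in nonincreasing order ([rootsR] lists the distinct real roots
   in increasing order).  All #|G| eigenvalues are listed, because a real
   symmetric matrix has a split characteristic polynomial. *)
Definition eigenvalues (R : rcfType) (G : sgraph) : seq R :=
  let p := char_poly (adjmx R G) in
  flatten [seq nseq (mup x p) x | x <- rev (rootsR p)].

(* The i-th largest eigenvalue, for 1 <= i <= #|G|. *)
Definition lambda (R : rcfType) (G : sgraph) (i : nat) : R :=
  (eigenvalues R G)`_i.-1.

(* Rational functions in x over F are elements of {fraction {poly F}}. *)
Definition coronal (F : fieldType) (n : nat) (M : 'M[F]_n) :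
    {fraction {poly F}} :=
  let xI_M := (tofrac 'X)%:M - map_mx (fun a : F => tofrac a%:P) M in
  ((const_mx 1 : 'cV_n)^T *m invmx xI_M *m (const_mx 1 : 'cV_n)) 0 0.

(* Main.v *)
(** Order the vertices as V(G1), I(G1), V(G2) and let B be the incidence matrix
    of G1.  The Schur complement with respect to xI - A(G2) puts Γ J into the
    I(G1)-block; a second one with respect to the V(G1)-block xI leaves
    det (x² I - xΓ J - B^T B).  Since B^T maps the all-ones vector to 2, this
    matrix is x² I - B^T (I + (xΓ/4) J) B, and Sylvester's identity with
    B B^T = A(G1) + r1 I reduces it to det ((x² - r1) I - A(G1) - (r1 xΓ/2) J),
    a rank one perturbation along an eigenvector of A(G1) for r1.  Finally r1 is
    the largest eigenvalue, and n1 r1 = 2 m1. *)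
Require Import Defs.
From mathcomp Require Import all_boot all_order all_algebra.
From mathcomp Require Import perm sesquilinear spectral polyrcf complex ring.

Import Order.TTheory GRing.Theory Num.Theory.
Local Open Scope ring_scope.

Set Implicit Arguments.
Unset Strict Implicit.
Unset Printing Implicit Defensive.

(** * Schur complements, Sylvester's identity and rank one perturbations *)

Lemma det_block_schur_dr (R : comUnitRingType) (m n : nat) (A : 'M[R]_m)
    (B : 'M_(m, n)) (C : 'M_(n, m)) (D : 'M_n) :
  D \in unitmx ->
  \det (block_mx A B C D) = \det D * \det (A - B *m invmx D *m C).
Proof.
move=> Du; have -> : block_mx A B C D =
    block_mx 1%:M (B *m invmx D) 0 1%:M
    *m block_mx (A - B *m invmx D *m C) 0 C D.
  by rewrite mulmx_block !mul1mx !mul0mx !add0r subrK mulmxKV.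
by rewrite det_mulmx det_ublock det_lblock !det1 !mul1r mulrC.
Qed.

Lemma det_block_schur_ul (R : comUnitRingType) (m n : nat) (A : 'M[R]_m)
    (B : 'M_(m, n)) (C : 'M_(n, m)) (D : 'M_n) :
  A \in unitmx ->
  \det (block_mx A B C D) = \det A * \det (D - C *m invmx A *m B).
Proof.
move=> Au; have -> : block_mx A B C D =
    block_mx 1%:M 0 (C *m invmx A) 1%:M
    *m block_mx A B 0 (D - C *m invmx A *m B).
  by rewrite mulmx_block !mul1mx !mul0mx !addr0 mulmxKV // addrC subrK.
by rewrite det_mulmx det_lblock det_ublock !det1 !mul1r.
Qed.

(** Sylvester's identity, by taking both Schur complements of one block matrix. Scaling its upper
    right block by [a] cancels the [a^-1] of the inverted diagonal block. *)
Lemma det_scalar_sub_mulC (F : fieldType) (m n : nat) (U : 'M[F]_(m, n))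
    (V : 'M_(n, m)) (a : F) :
  a != 0 -> a ^+ n * \det (a%:M - U *m V) = a ^+ m * \det (a%:M - V *m U).
Proof.
move=> a0; have unit_a k : (a%:M : 'M[F]_k) \in unitmx.
  by rewrite unitmxE det_scalar unitrX // unitfE.
have aVK p q (M : 'M[F]_(p, q)) : a *: M *m a^-1%:M = M.
  by rewrite mul_mx_scalar scalerA mulVf // scale1r.
have := det_block_schur_dr (a%:M : 'M_m) (a *: U) V (unit_a n).
rewrite (det_block_schur_ul _ _ _ (unit_a m)) !det_scalar !invmx_scalar aVK => <-.
by rewrite mul_mx_scalar -scalemxAl -scalemxAr scalerA mulVf // scale1r.
Qed.

(** A constant matrix is a column times a row, so Sylvester's identity at [a = 1] leaves a 1 by 1
    determinant. *)
Lemma det_id_sub_const (F : fieldType) (n : nat) (c : F) :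
  \det (1%:M - const_mx c : 'M[F]_n) = 1 - c *+ n.
Proof.
have := det_scalar_sub_mulC (const_mx c : 'cV[F]_n) (const_mx 1 : 'rV_n)
  (oner_neq0 F).
rewrite !expr1n !mul1r.
have -> : (const_mx c : 'cV_n) *m (const_mx 1 : 'rV_n) = const_mx c :> 'M[F]_n.
  by apply/matrixP=> i j; rewrite !mxE big_ord1 !mxE mulr1.
move=> ->; rewrite det_mx11 !mxE; under eq_bigr do rewrite !mxE mul1r.
by rewrite sumr_const card_ord.
Qed.

Lemma const_mxE (R : nzRingType) (m n : nat) (a : R) :
  const_mx a = a *: const_mx 1 :> 'M[R]_(m, n).
Proof. by apply/matrixP=> i j; rewrite !mxE mulr1. Qed.

(** This is where the coronal appears: with [M] the inverse of [x - A2], the Schur correction is the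
    coronal times J. *)
Lemma mul_const_mx_const (F : fieldType) (m n p q : nat) (M : 'M[F]_(n, p)) :
  const_mx 1 *m M *m const_mx 1 =
  const_mx (((const_mx 1 : 'cV_n)^T *m M *m (const_mx 1 : 'cV_p)) 0 0)
  :> 'M_(m, q).
Proof.
apply/matrixP=> i j; rewrite !mxE; apply: eq_bigr => k _; rewrite !mxE.
by congr (_ * _); apply: eq_bigr => l _; rewrite !mxE.
Qed.

(* Factor out [t - A]: as [A J = r J], it maps [1 - d / (t - r) J] to
   [t - A - d J]. *)
Lemma det_scalar_sub_const (F : fieldType) (n : nat) (A : 'M[F]_n) (r t d : F) :
  A *m const_mx 1 = const_mx r :> 'M_n -> t != r ->
  \det (t%:M - A - const_mx d) * (t - r) = \det (t%:M - A) * (t - r - d *+ n).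
Proof.
move=> AJ tr; have tr0 : t - r != 0 by rewrite subr_eq0.
have -> : t%:M - A - const_mx d
    = (t%:M - A) *m (1%:M - const_mx (d / (t - r))).
  rewrite mulmxBr mulmx1 [const_mx (_ / _)]const_mxE -scalemxAr mulmxBl AJ.
  by rewrite mul_scalar_mx (const_mxE _ _ r) -scalerBl scalerA divfK // -const_mxE.
rewrite det_mulmx det_id_sub_const -mulrA mulrBl mul1r mulrnAl divfK //.
Qed.

(** * The determinant of the three-block matrix *)

Section BlockDeterminant.
Variables (F : fieldType) (n m k : nat) (A : 'M[F]_n) (B : 'M[F]_(n, m)).
Variables (A2 : 'M[F]_k) (r : nat) (x : F).
Hypothesis BBT : B *m B^T = A + r%:R%:M.
Hypothesis AJ : A *m const_mx 1 = const_mx r%:R :> 'M[F]_n.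
Hypothesis A_sym : A^T = A.
Hypothesis colB : (const_mx 1 : 'rV_n) *m B = const_mx 2%:R.
Hypothesis nr : (n * r = 2 * m)%N.
Let g : F :=
  ((const_mx 1 : 'cV_k)^T *m invmx (x%:M - A2) *m (const_mx 1 : 'cV_k)) 0 0.

(** The factors [x ^+ 2 - (2 * r)%:R] and [x ^+ n] stand on the left to avoid division: the first is
    the factor of the last determinant that belongs to the eigenvalue [r] of [A], the second turns
    the exponent [m - n] into [m]. *)
Lemma det_subdiv_edge_join_block :
  2%:R != 0 :> F -> x != 0 -> x ^+ 2 != (2 * r)%:R -> x%:M - A2 \in unitmx ->
  \det (block_mx (block_mx x%:M (- B) (- B^T) x%:M) (col_mx 0 (const_mx (- 1)))
     (row_mx 0 (const_mx (- 1))) (x%:M - A2))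
    * (x ^+ 2 - (2 * r)%:R) * x ^+ n =
  \det (x%:M - A2) * x ^+ m * (x ^+ 2 - m%:R * x * g - (2 * r)%:R)
    * \det ((x ^+ 2 - r%:R)%:M - A).
Proof.
move=> two0 x0 xr A2u.
have xu : (x%:M : 'M_n) \in unitmx.
  by rewrite unitmxE det_scalar unitrX // unitfE.
have x2 : x ^+ 2 != 0 by rewrite expf_neq0.
rewrite det_block_schur_dr // mul_col_mx mul_col_row !(mul0mx, mulmx0).
have -> : (const_mx (- 1) : 'M_(m, k)) *m invmx (x%:M - A2) *m const_mx (- 1)
    = const_mx g :> 'M_m.
  rewrite -mul_const_mx_const.
  have cN p q : const_mx (- 1) = - const_mx 1 :> 'M[F]_(p, q).
    by apply/matrixP=> i j; rewrite !mxE.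
  by rewrite !cN mulNmx mulNmx mulmxN opprK.
rewrite opp_block_mx add_block_mx !oppr0 !addr0 det_block_schur_ul // det_scalar.
rewrite invmx_scalar mul_mx_scalar -scalemxAl mulNmx mulmxN opprK.
(* As [B^T] maps the all-ones vector to [2], the term [x g J] is absorbed
   between [B^T] and [B], so that Sylvester's identity applies. *)
set c := x * g / (2%:R * 2%:R).
have Bcol : B^T *m const_mx 1 = const_mx 2%:R :> 'M_(m, 1).
  by rewrite -trmx_const -trmx_mul colB trmx_const.
have JA : const_mx 1 *m A = const_mx r%:R :> 'M_n.
  by rewrite -trmx_const -[in LHS]A_sym -trmx_mul AJ trmx_const.
(* Each of the two products with all-ones vectors yields a factor 2; together they cancel the
   denominator of [c]. *)
have BJB : B^T *m const_mx c *m B = x *: const_mx g.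
  have -> : const_mx c
      = c *: ((const_mx 1 : 'cV_n) *m (const_mx 1 : 'rV_n)) :> 'M[F]_n.
    by apply/matrixP=> i j; rewrite !mxE big_ord1 !mxE !mulr1.
  rewrite -scalemxAr mulmxA Bcol -scalemxAl -mulmxA colB.
  apply/matrixP=> i j; rewrite !mxE big_ord1 !mxE /c divfK ?mulf_neq0 //.
(* Scaling by [x] clears [x^-1]; the determinant, of size [m], pays with [x ^+ m]. *)
have sch : x *: (x%:M - const_mx g - x^-1 *: (B^T *m B)) =
    (x ^+ 2)%:M - B^T *m ((1%:M + const_mx c) *m B).
  rewrite mulmxA mulmxDr mulmx1 mulmxDl opprD addrA !scalerBr scale_scalar_mx.
  by rewrite scalerA mulfV // scale1r -expr2 addrAC BJB.
have dsch : x ^+ m * \det (x%:M - const_mx g - x^-1 *: (B^T *m B)) =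
   \det ((x ^+ 2)%:M - B^T *m ((1%:M + const_mx c) *m B)).
  by rewrite -sch detZ.
have := det_scalar_sub_mulC B^T ((1%:M + const_mx c) *m B) x2.
rewrite -dsch -mulmxA BBT.
(* [const_mx c] times [A] and [const_mx c] times [r%:R%:M] both equal [c * r] times J, so [d] is
   [2 * r * c]. *)
set d := r%:R * x * g / 2%:R.
have -> : (x ^+ 2)%:M - (1%:M + const_mx c) *m (A + r%:R%:M)
   = (x ^+ 2 - r%:R)%:M - A - const_mx d.
  rewrite mulmxDl mul1mx mulmxDr mul_mx_scalar [const_mx c]const_mxE -scalemxAl JA.
  apply/matrixP=> i j; rewrite !mxE mulr1 mulrnBl /d /c.
  by field; rewrite (natrM _ 2 2) mulf_neq0 two0.
have t_r : x ^+ 2 - r%:R != r%:R by rewrite subr_eq -natrD addnn -mul2n.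
have := det_scalar_sub_const d AJ t_r.
(* The handshake identity [n * r = 2 * m] absorbs the denominator 2 of [d]. *)
have -> : d *+ n = m%:R * x * g.
  have : n%:R * r%:R = 2%:R * m%:R :> F by rewrite -!natrM nr.
  move=> nr'; rewrite -[d *+ n]mulr_natr /d; apply: (mulfI two0).
  transitivity (n%:R * r%:R * x * g); first by field.
  by rewrite nr'; ring.
set S := \det (_ - _ - _ *: _); set T := \det (_ - _ - _).
set D := \det (x%:M - A2); set P := \det (_ - A) => TP ST.
(* Sylvester's identity was applied at [x ^+ 2], giving exponents [2n] and [2m]; one [x ^+ m]
   cancels against the scaling above. *)
have {}ST : x ^+ n * (x ^+ n * S) = x ^+ m * T.
  apply: (mulfI (expf_neq0 m x0)).
  move: ST; rewrite -!exprM !mul2n -!addnn !exprD => ST.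
  by transitivity (x ^+ n * x ^+ n * (x ^+ m * S)); [ring|rewrite ST mulrA].
transitivity (D * (x ^+ n * (x ^+ n * S)) * (x ^+ 2 - (2 * r)%:R)); first by ring.
transitivity (D * x ^+ m * (T * (x ^+ 2 - r%:R - r%:R))).
  by rewrite ST; ring.
by rewrite TP; ring.
Qed.

End BlockDeterminant.

(** * Determinants under relabelling, and eigenvalues of symmetric matrices *)

(** Rows and columns undergo the same permutation, so its sign occurs twice. Two sizes are allowed
    because the number of vertices of the join is only provably, not definitionally, the sum of the
    block sizes. *)
Lemma det_mxsub_bij (R : comNzRingType) (m n : nat) (f : 'I_m -> 'I_n)
    (A : 'M[R]_n) :
  bijective f -> \det (mxsub f f A) = \det A.
Proof.
move=> fbij; have mn : m = n by have := bij_eq_card fbij; rewrite !card_ord.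
subst m; pose s := perm (bij_inj fbij).
have -> : mxsub f f A = row_perm s (col_perm s A).
  by apply/matrixP=> i j; rewrite !mxE !permE.
rewrite row_permE col_permE !det_mulmx !det_perm odd_permV mulrCA.
by rewrite -signr_addb addbb mulr1.
Qed.

Lemma char_poly_similar (R : comUnitRingType) (n : nat) (P A : 'M[R]_n) :
  P \in unitmx -> char_poly (invmx P *m A *m P) = char_poly A.
Proof.
move=> Pu; have PK : map_mx polyC (invmx P) *m map_mx polyC P = 1%:M.
  by rewrite -map_mxM mulVmx // map_mx1.
rewrite /char_poly; have -> : char_poly_mx (invmx P *m A *m P)
    = map_mx polyC (invmx P) *m char_poly_mx A *m map_mx polyC P.
  rewrite /char_poly_mx mulmxBr mulmxBl mul_mx_scalar -scalemxAl PK !map_mxM.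
  by rewrite scalemx1.
by rewrite !det_mulmx mulrAC -det_mulmx PK det1 mul1r.
Qed.

(** Over the complex closure of [R] the matrix is hermitian, so the spectral theorem diagonalizes it
    with real diagonal; the factorization descends to [R] because the embedding of polynomials is
    injective. *)
Lemma char_poly_sym_split (R : rcfType) (n : nat) (A : 'M[R]_n) :
  A^T = A -> exists s : seq R, char_poly A = \prod_(a <- s) ('X - a%:P).
Proof.
move=> A_sym; pose C := map_mx (real_complex R) A.
have Cherm : C \is hermsymmx.
  apply: realsym_hermsym.
    apply/is_hermitianmxP; rewrite expr0 scale1r map_mx_id //.
    by apply/esym; rewrite map_trmx A_sym.
  apply/mxOverP=> i j; rewrite mxE; by apply/complex_realP; exists (A i j).
have dE i : real_complex R (complex.Re (spectral_diag C 0 i)) = spectral_diag C 0 i.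
  by apply: RRe_real; apply/mxOverP: 0 i; apply: hermitian_spectral_diag_real.
exists [seq complex.Re (spectral_diag C 0 i) | i <- enum 'I_n].
apply: (map_poly_inj (real_complex R)).
rewrite map_char_poly -/C.
have /orthomx_spectralP/(congr1 char_poly) -> := hermitian_normalmx Cherm.
rewrite char_poly_similar ?spectral_unit //.
rewrite char_poly_trig ?diag_mx_is_trig // big_map rmorph_prod big_enum /=.
apply: eq_bigr => i _; rewrite mxE eqxx mulr1n rmorphB /= map_polyX map_polyC /=.
by rewrite dE.
Qed.

(** The multiplicity of a root of the product is its number of occurrences in [s], and the distinct
    roots are those of [undup s]. *)
Lemma eigenvalues_perm (R : rcfType) (G : sgraph) (s : seq R) :
  char_poly (adjmx R G) = \prod_(a <- s) ('X - a%:P) ->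
  perm_eq (eigenvalues R G) s.
Proof.
rewrite /eigenvalues => ps; rewrite ps; apply: perm_trans (perm_count_undup s).
under eq_map do rewrite mu_prod_XsubC.
apply: perm_flatten; apply: perm_map.
rewrite perm_rev; apply: uniq_perm; rewrite ?undup_uniq //.
  exact: uniq_roots.
move=> a; rewrite mem_undup -(root_prod_XsubC s) -roots_on_rootsR ?in_itv //=.
by rewrite monic_neq0 // monic_prod_XsubC.
Qed.

Lemma adjmx_sym (R : nzRingType) (G : sgraph) : (adjmx R G)^T = adjmx R G.
Proof. by apply/matrixP=> i j; rewrite !mxE adj_sym. Qed.

Lemma char_poly_eigenvalues (R : rcfType) (G : sgraph) :
  char_poly (adjmx R G) = \prod_(a <- eigenvalues R G) ('X - a%:P).
Proof.
have [s ps] := char_poly_sym_split (adjmx_sym R G).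
by rewrite (perm_big _ (eigenvalues_perm ps)).
Qed.

Lemma size_eigenvalues (R : rcfType) (G : sgraph) :
  size (eigenvalues R G) = #|G|.
Proof.
have := size_char_poly (adjmx R G).
by rewrite char_poly_eigenvalues size_prod_XsubC => -[].
Qed.

(** * The largest eigenvalue of a regular graph *)

Section Regular.
Variables (G : sgraph) (r : nat).
Hypothesis Greg : regular G r.

Lemma sum_adjmx_row (R : nzRingType) i : \sum_j adjmx R G i j = r%:R.
Proof.
under eq_bigr do rewrite mxE.
rewrite -(Greg (enum_val i)) -sum1dep_card natr_sum [RHS]big_mkcond /=.
rewrite [RHS](reindex (@enum_val G G)) /=; last exact/onW_bij/enum_val_bij.
by apply: eq_bigr => j _; rewrite mulrb.
Qed.

Lemma adjmx_const (R : nzRingType) n :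
  adjmx R G *m const_mx 1 = const_mx r%:R :> 'M[R]_(#|G|, n).
Proof.
apply/matrixP=> i j; rewrite mxE [RHS]mxE -(sum_adjmx_row R i).
by apply: eq_bigr => k _; rewrite [X in _ * X]mxE mulr1.
Qed.

(** The all-ones vector is an eigenvector, nonzero because [G] has a vertex. [eigenvalue] concerns
    row vectors, hence the passage through the transpose. *)
Lemma eigenvalue_regular (R : rcfType) : eigenvalue (adjmx R G) r%:R.
Proof.
apply/eigenvalueP; exists (const_mx 1).
  rewrite -const_mxE -trmx_const -[in LHS]adjmx_sym -trmx_mul adjmx_const.
  by rewrite trmx_const.
have i0 := Ordinal (vertex_gt0 G); apply/eqP=> /matrixP/(_ 0 i0)/eqP.
by rewrite !mxE oner_eq0.
Qed.

(* At a coordinate [i] of maximal modulus of an eigenvector, [|a v_i|] is a sum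
   of [r] moduli bounded by [|v_i|]. *)
Lemma eigenvalue_regular_le (R : rcfType) (a : R) :
  eigenvalue (adjmx R G) a -> a <= r%:R.
Proof.
move=> /eigenvalueP[v vA v0].
have i0 := Ordinal (vertex_gt0 G).
pose i := [arg max_(i > i0) `|v 0 i|]%O.
have imax j : `|v 0 j| <= `|v 0 i|.
  by rewrite /i; case: arg_maxP => // k _; apply.
have vi : 0 < `|v 0 i|.
  rewrite normr_gt0; apply: contraNneq v0 => vi0; apply/eqP/rowP=> j; rewrite mxE.
  by apply/eqP; rewrite -normr_le0; have := imax j; rewrite vi0 normr0.
apply: le_trans (ler_norm a) _; rewrite -(ler_pM2r vi) -normrM.
have := congr1 (fun M : 'rV_ _ => M 0 i) vA; rewrite [RHS]mxE mxE => <-.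
apply: le_trans (ler_norm_sum _ _ _) _; rewrite -(sum_adjmx_row R i) mulr_suml.
apply: ler_sum => j _; rewrite normrM mulrC -{1}adjmx_sym mxE.
have adj_ge0 : 0 <= adjmx R G i j by rewrite mxE ler0n.
by rewrite (ger0_norm adj_ge0) ler_wpM2l.
Qed.

Lemma head_eigenvalues (R : rcfType) :
  eigenvalues R G = r%:R :: behead (eigenvalues R G).
Proof.
set p := char_poly (adjmx R G).
have p0 : p != 0 by rewrite monic_neq0 // char_poly_monic.
have mem_roots a : (a \in rev (rootsR p)) = eigenvalue (adjmx R G) a.
  by rewrite mem_rev -roots_on_rootsR // in_itv /= eigenvalue_root_char.
rewrite /eigenvalues -/p.
have : sorted (fun x y => y < x) (rev (rootsR p)).
  by rewrite rev_sorted sorted_roots.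
case: (rev _) mem_roots => [|y s] mem_roots /=.
  by have := mem_roots r%:R; rewrite eigenvalue_regular.
(* The first block of the list is nonempty only if its root has positive multiplicity, which is
   checked once [y] is known to be [r]. *)
move=> ys; suff -> : y = r%:R.
  have : (0 < mup r%:R p)%N.
    by rewrite -XsubC_dvd // dvdp_XsubCl -eigenvalue_root_char eigenvalue_regular.
  by case: (mup _ _).
(* [y] is an eigenvalue, hence at most [r]; [r] is one of the listed roots, hence at most their head
   [y]. *)
apply/eqP; rewrite eq_le eigenvalue_regular_le -?mem_roots ?mem_head //=.
have := mem_roots r%:R; rewrite eigenvalue_regular inE => /orP[/eqP->//|rs].
have gt_trans : transitive (fun u v : R => v < u).
  by move=> b a c ba cb; apply: lt_trans ba.
exact/ltW/(allP (order_path_min gt_trans ys)).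
Qed.

End Regular.

(** * Edge counts and the incidence matrix *)

Lemma edgesP (G : sgraph) (e : {set G}) :
  reflect (exists x y, adj x y /\ e = [set x; y]) (e \in edges G).
Proof.
rewrite inE.
apply: (iffP existsP) => [[x /existsP[y /andP[xy /eqP->]]]|[x [y [xy ->]]]].
  by exists x, y.
by exists x; apply/existsP; exists y; rewrite xy eqxx.
Qed.

Lemma edge_mem2 (G : sgraph) (e : {set G}) (x y : G) :
  e \in edges G -> x \in e -> y \in e -> x != y -> adj x y /\ e = [set x; y].
Proof.
move=> /edgesP[u [v [uv ->]]] /set2P[] -> /set2P[] ->; rewrite ?eqxx // => _.
by rewrite adj_sym setUC.
Qed.

Lemma card_edge (G : sgraph) (e : {set G}) : e \in edges G -> #|e| = 2%N.
Proof.
move=> /edgesP[u [v [uv ->]]]; rewrite cards2.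
by case: eqVneq uv => // ->; rewrite adj_irrefl.
Qed.

(** The map from a neighbour [y] to [[set x; y]] is injective, since [x] is not adjacent to
    itself. *)
Lemma card_edges_at (G : sgraph) (x : G) :
  #|[set e in edges G | x \in e]| = #|[set y | adj x y]|.
Proof.
have -> : [set e in edges G | x \in e]
    = (fun y => [set x; y]) @: [set y | adj x y].
  apply/setP=> e; rewrite inE; apply/andP/imsetP=> [[]|[y]].
    move=> /edgesP[u [v [uv ->]]] /set2P[] xE; subst x.
      by exists v; rewrite ?inE.
    by exists u; rewrite ?inE 1?adj_sym 1?setUC.
  by rewrite inE => xy ->; split; [apply/edgesP; exists x, y | rewrite set21].
rewrite card_in_imset // => y z; rewrite !inE => xy xz yz.
have : y \in [set x; z] by rewrite -yz set22.
by case/set2P=> // yx; rewrite yx adj_irrefl in xy.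
Qed.

Lemma card_edges_at2 (G : sgraph) (x y : G) : x != y ->
  #|[set e in edges G | (x \in e) && (y \in e)]| = adj x y.
Proof.
move=> xy; case: (boolP (adj x y)) => [axy|naxy].
  transitivity #|[set [set x; y]]|; last by rewrite cards1.
  apply: eq_card => e.
  rewrite inE in_set1; apply/and3P/eqP=> [[eE xe ye]|->].
    by have [] := edge_mem2 eE xe ye xy.
  by rewrite set21 set22; split=> //; apply/edgesP; exists x, y.
apply/eqP; rewrite cards_eq0; apply/eqP/setP=> e; rewrite [RHS]inE [LHS]inE.
apply: contraNF naxy => /and3P[eE xe ye].
by have [] := edge_mem2 eE xe ye xy.
Qed.

Section Incidence.
Variable G : sgraph.
Local Notation E := ({e : {set G} | e \in edges G} : finType).

(** The columns run over the same subtype as the inserted vertices of [subdiv_vertex], so this is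
    also a block of the adjacency matrix of the subdivision. *)
Definition incmx (R : nzRingType) : 'M[R]_(#|G|, #|{: E}|) :=
  \matrix_(i, j) ((enum_val i : G) \in val (enum_val j : E))%:R.

Lemma sum_incmx (R : nzRingType) (P : pred {set G}) :
  \sum_(j < #|{: E}|) (P (val (enum_val j : E)))%:R
  = #|[set e in edges G | P e]|%:R :> R.
Proof.
rewrite -sum1dep_card natr_sum [RHS]big_mkcondr [RHS]big_sub /=.
rewrite [RHS](reindex (@enum_val E E)); last exact/onW_bij/enum_val_bij.
by apply: eq_bigr => j _; case: (P _).
Qed.

Lemma const_mul_incmx (R : nzRingType) n :
  const_mx 1 *m incmx R = const_mx 2%:R :> 'M[R]_(n, _).
Proof.
apply/matrixP=> i j; rewrite mxE [RHS]mxE.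
rewrite -(card_edge (valP (enum_val j : E))) -sum1_card natr_sum.
rewrite [RHS]big_mkcond.
rewrite [RHS](reindex (@enum_val G G)); last exact/onW_bij/enum_val_bij.
by apply: eq_bigr => k _; rewrite !mxE mul1r mulrb.
Qed.

Variable r : nat.
Hypothesis Greg : regular G r.

(** An entry counts the edges through two given vertices: the degree on the diagonal, and elsewhere
    1 or 0 according to adjacency. *)
Lemma incmx_mul_tr (R : nzRingType) :
  incmx R *m (incmx R)^T = adjmx R G + r%:R%:M.
Proof.
apply/matrixP=> i j; rewrite !mxE.
under eq_bigr => k _ do rewrite !mxE -natrM mulnb.
rewrite (sum_incmx R (fun e => (enum_val i \in e) && (enum_val j \in e))).
have [->|ij] := eqVneq i j.
  rewrite adj_irrefl add0r mulr1n -(Greg (enum_val j)) -card_edges_at.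
  by congr _%:R; apply: eq_card => e; rewrite !inE andbb.
by rewrite card_edges_at2 ?(inj_eq enum_val_inj) // addr0.
Qed.

(** Double counting of the incident pairs of a vertex and an edge. *)
Lemma regular_handshake : (#|G| * r = 2 * #|edges G|)%N.
Proof.
transitivity (\sum_(x : G) \sum_(e in edges G | x \in e) 1)%N.
  under eq_bigr => x _ do rewrite sum1dep_card card_edges_at Greg.
  by rewrite sum_nat_const.
rewrite (exchange_big_dep (mem (edges G))) /=; last by move=> x e _ /andP[].
transitivity (\sum_(e in edges G) 2)%N; last by rewrite sum_nat_const mulnC.
apply: eq_bigr => e eE; rewrite -(card_edge eE) -sum1_card.
by apply: eq_bigl => x; rewrite eE.
Qed.

End Incidence.

(** * Block form of the adjacency matrix of the join *)

Section VertexOrder.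
Variables G1 G2 : sgraph.
Local Notation E := ({e : {set G1} | e \in edges G1} : finType).

(** An enumeration in the order V(G1), I(G1), V(G2), independent of the one that [enum] gives on the
    sum type. *)
Definition sej_of_ord (i : 'I_((#|G1| + #|{: E}|) + #|G2|)) :
    subdiv_edge_join G1 G2 :=
  match split i with
  | inl a => inl (match split a with
                  | inl u => inl (enum_val (u : 'I_#|G1|))
                  | inr e => inr (enum_val (e : 'I_#|{: E}|))
                  end)
  | inr v => inr (enum_val (v : 'I_#|G2|))
  end.

Lemma sej_of_ord_bij : bijective sej_of_ord.
Proof.
pose g (v : subdiv_edge_join G1 G2) : 'I_((#|G1| + #|{: E}|) + #|G2|) :=
  match v with
  | inl (inl u) => lshift _ (lshift _ (enum_rank u))
  | inl (inr e) => lshift _ (rshift _ (enum_rank e))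
  | inr v => rshift _ (enum_rank v)
  end.
exists g => [i|[[u|e]|v]].
- rewrite /sej_of_ord -[RHS]splitK; case: (split i) => [a|v] /=.
    by rewrite -[RHS](congr1 (lshift _) (splitK a)); case: (split a) => [u|e] /=;
      rewrite enum_valK.
  by rewrite enum_valK.
- by rewrite /sej_of_ord /g (unsplitK (inl _)) (unsplitK (inl _)) enum_rankK.
- by rewrite /sej_of_ord /g (unsplitK (inl _)) (unsplitK (inr _)) enum_rankK.
- by rewrite /sej_of_ord /g (unsplitK (inr _)) enum_rankK.
Qed.

(** [enum_rank] cancels the [enum_val] inside [adjmx], so that entries are indexed by [sej_of_ord]
    and can be read off block by block. *)
Lemma adjmx_sej (R : nzRingType) :
  mxsub (enum_rank \o sej_of_ord) (enum_rank \o sej_of_ord)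
    (adjmx R (subdiv_edge_join G1 G2)) =
  block_mx (block_mx 0 (incmx G1 R) (incmx G1 R)^T 0) (col_mx 0 (const_mx 1))
    (row_mx 0 (const_mx 1)) (adjmx R G2).
Proof.
apply/matrixP=> i j; rewrite 2!mxE /= !enum_rankK /sej_of_ord.
rewrite -[in RHS](splitK i) -[in RHS](splitK j).
case: (split i) => [a|v]; case: (split j) => [b|w] /=; last first.
- by rewrite block_mxEdr mxE.
- rewrite block_mxEdl -[in RHS](splitK b); case: (split b) => [u|e] /=.
    by rewrite row_mxEl mxE inE.
  by rewrite row_mxEr mxE inE.
- rewrite block_mxEur -[in RHS](splitK a); case: (split a) => [u|e] /=.
    by rewrite col_mxEu mxE inE.
  by rewrite col_mxEd mxE inE.
rewrite block_mxEul -[in RHS](splitK a) -[in RHS](splitK b).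
case: (split a) => [u|e]; case: (split b) => [u'|e'] /=.
- by rewrite block_mxEul mxE.
- by rewrite block_mxEur mxE.
- by rewrite block_mxEdl !mxE.
- by rewrite block_mxEdr mxE.
Qed.

End VertexOrder.

(** * Evaluation in an extension field and the final identity *)

(** The morphism [f] allows a point outside the base field: the eigenvalues lie in [R], while the
    point will be a rational function. *)
Lemma char_poly_eval (A B : fieldType) (f : {rmorphism A -> B}) (n : nat)
    (M : 'M[A]_n) (t : B) :
  \det (t%:M - map_mx f M) = (map_poly f (char_poly M)).[t].
Proof.
rewrite map_char_poly /char_poly -horner_evalE -det_map_mx; congr (\det _).
rewrite map_mxB /= map_scalar_mx -map_mx_comp /= horner_evalE hornerX.
by congr (_ - _); apply/matrixP=> i j; rewrite !mxE /= horner_evalE hornerC.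
Qed.

Lemma map_adjmx (A B : nzRingType) (f : {rmorphism A -> B}) (G : sgraph) :
  map_mx f (adjmx A G) = adjmx B G.
Proof. by apply/matrixP=> i j; rewrite !mxE rmorph_nat. Qed.

Lemma det_scalar_sub_adjmx_sej (F : fieldType) (G1 G2 : sgraph) (x : F) :
  let B := incmx G1 F in
  \det (x%:M - adjmx F (subdiv_edge_join G1 G2)) =
  \det (block_mx (block_mx x%:M (- B) (- B^T) x%:M) (col_mx 0 (const_mx (- 1)))
     (row_mx 0 (const_mx (- 1))) (x%:M - adjmx F G2)).
Proof.
move=> B; have hbij :=
  bij_comp (@enum_rank_bij (subdiv_edge_join G1 G2)) (sej_of_ord_bij G1 G2).
rewrite -(det_mxsub_bij _ hbij); congr (\det _).
have -> : mxsub (enum_rank \o @sej_of_ord G1 G2) (enum_rank \o @sej_of_ord G1 G2)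
      (x%:M - adjmx F (subdiv_edge_join G1 G2))
    = x%:M - mxsub (enum_rank \o @sej_of_ord G1 G2)
        (enum_rank \o @sej_of_ord G1 G2) (adjmx F (subdiv_edge_join G1 G2)).
  by apply/matrixP=> i j; rewrite !mxE (inj_eq (bij_inj hbij)).
rewrite adjmx_sej !scalar_mx_block !opp_block_mx opp_col_mx opp_row_mx.
rewrite !add_block_mx.
have cN p q : - const_mx 1 = const_mx (- 1) :> 'M[F]_(p, q).
  by apply/matrixP=> i j; rewrite !mxE.
by rewrite !oppr0 !cN !add0r !addr0.
Qed.

Lemma det_scalar_sub_adjmx_regular (R : rcfType) (F : fieldType)
    (f : {rmorphism R -> F}) (G : sgraph) (r : nat) (t : F) :
  regular G r ->
  \det (t%:M - adjmx F G) =
    (t - r%:R) * \prod_(2 <= i < #|G|.+1) (t - f (lambda R G i)).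
Proof.
move=> Greg; rewrite -(map_adjmx f) char_poly_eval char_poly_eigenvalues.
rewrite rmorph_prod horner_prod /=.
under eq_bigr do rewrite rmorphB /= map_polyX map_polyC /= hornerXsubC.
rewrite (head_eigenvalues Greg) big_cons rmorph_nat; congr (_ * _).
(* Two shifts make the range start at 0. [lambda] counts from 1, so its value at [i.+2] is entry
   [i.+1] of the list, that is entry [i] of the tail. *)
rewrite (big_nth 0) size_behead size_eigenvalues big_add1 /=.
rewrite -{1}[#|G|](prednK (vertex_gt0 G)) big_add1 /=.
by apply: eq_bigr => i _; rewrite /lambda nth_behead.
Qed.

(** The identity at a point [x] of any field over [R]; the theorem is the case of the indeterminate
    in the field of fractions. *)
Lemma det_scalar_sub_adjmx_sej_regular (R : rcfType) (F : fieldType)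
    (f : {rmorphism R -> F}) (G1 G2 : sgraph) (r : nat) (x : F) :
  let n := #|G1| in
  let m := #|edges G1| in
  let one : 'cV_#|G2| := const_mx 1 in
  let g := (one^T *m invmx (x%:M - adjmx F G2) *m one) 0 0 in
  regular G1 r -> x != 0 -> x ^+ 2 != (2 * r)%:R ->
  x%:M - adjmx F G2 \in unitmx ->
  \det (x%:M - adjmx F (subdiv_edge_join G1 G2)) =
    \det (x%:M - adjmx F G2) * x ^ (m%:Z - n%:Z)
    * (x ^+ 2 - m%:R * x * g - (2 * r)%:R)
    * \prod_(2 <= i < n.+1) (x ^+ 2 - r%:R - f (lambda R G1 i)).
Proof.
move=> n m one g Greg x0 xr A2u.
have two0 : 2%:R != 0 :> F by rewrite -(rmorph_nat f) fmorph_eq0 pnatr_eq0.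
have cardE : #|{: {e : {set G1} | e \in edges G1}}| = m by rewrite card_sig.
have nr : (#|G1| * r = 2 * #|{: {e : {set G1} | e \in edges G1}}|)%N.
  by rewrite cardE regular_handshake.
have := det_subdiv_edge_join_block (incmx_mul_tr Greg F) (adjmx_const Greg F _)
  (adjmx_sym F G1) (const_mul_incmx G1 F 1) nr two0 x0 xr A2u.
rewrite -det_scalar_sub_adjmx_sej (det_scalar_sub_adjmx_regular f _ Greg) cardE.
rewrite -/one -/g -/n.
move: (\det _) (\det _) g (\prod_(_ <= _ < _) _) => p q g P.
(* Otherwise [field] unfolds the exponents [#|G1|] and [#|edges G1|]. *)
clearbody n m => {nr cardE} pE.
have xr0 : x ^+ 2 - (2 * r)%:R != 0 by rewrite subr_eq0.
(* [pE] carries the factor for the eigenvalue [r] on both sides; it and [x ^+ n] are nonzero and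
   cancel. *)
apply: (mulIf (expf_neq0 n x0)); apply: (mulIf xr0).
rewrite mulrAC pE expfzDr // -exprnN -exprnP.
by field; rewrite expf_neq0.
Qed.

Theorem theorem3p1 (R : rcfType) (G1 G2 : sgraph) (r1 n1 m1 n2 : nat)
    (hreg : regular G1 r1) (hn1 : #|G1| = n1) (hm1 : #|edges G1| = m1)
    (hn2 : #|G2| = n2) :
  let x : {fraction {poly R}} := tofrac 'X in
  tofrac (char_poly (adjmx R (subdiv_edge_join G1 G2))) =
    tofrac (char_poly (adjmx R G2)) * x ^ (m1%:Z - n1%:Z)
    * (x ^+ 2 - m1%:R * x * coronal (adjmx R G2) - (2 * r1)%:R)
    * \prod_(2 <= i < n1.+1) (x ^+ 2 - r1%:R - tofrac (lambda R G1 i)%:P).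
Proof.
move=> x; subst n1 m1 n2.
pose iota : {rmorphism R -> {fraction {poly R}}} := @tofrac {poly R} \o polyC.
have iotaE G : map_mx (fun a : R => tofrac a%:P) (adjmx R G) = adjmx _ G.
  exact: (map_adjmx iota G).
have charE G : tofrac (char_poly (adjmx R G)) = \det (x%:M - adjmx _ G).
  rewrite -det_map_mx map_mxB /= map_scalar_mx /= -map_mx_comp.
  congr (\det (_ - _)).
  by rewrite -iotaE; apply/matrixP=> i j; rewrite !mxE.
have x0 : x != 0 by rewrite tofrac_eq0 polyX_eq0.
(* A polynomial of degree 2 is not a constant. *)
have xr : x ^+ 2 != (2 * r1)%:R.
  have -> : (2 * r1)%:R = tofrac (2 * r1)%:R%:P :> {fraction {poly R}}.
    by rewrite polyC_natr rmorph_nat.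
  rewrite -rmorphXn tofrac_eq; apply/eqP=> /(congr1 (fun p : {poly R} => size p)).
  by rewrite size_polyXn size_polyC; case: (_ != 0).
(* The determinant is the image of a monic polynomial, hence nonzero. *)
have A2u : x%:M - adjmx _ G2 \in unitmx.
  by rewrite unitmxE unitfE -charE tofrac_eq0 monic_neq0 // char_poly_monic.
rewrite !charE /coronal iotaE.
exact: (det_scalar_sub_adjmx_sej_regular iota hreg x0 xr A2u).
Qed.
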